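(* Let $N=\{1,\dots,p\}$ be the set of players, $\mathbb{R}^n=\prod_{\nu\in N}\mathbb{R}^{n_\nu}$, let $\|\cdot\|$ be a norm in $\mathbb{R}^n$, let $X$ be a convex and non-empty subset of $\mathbb{R}^n$, and for each $\nu\in N$ let $\theta_\nu:\mathbb{R}^n\to\mathbb{R}$ be a function. Then any projected solution of the generalized Nash game in the sense of Rosen defined by $X$ and $\{\theta_\nu\}_{\nu\in N}$ is a classical solution of it, i.e. a generalized Nash equilibrium in the sense of Rosen.
   Context: Notation: a vector $x\in\mathbb{R}^n$ is written $x=(x^\nu,x^{-\nu})$, where $x^\nu\in\mathbb{R}^{n_\nu}$ is the component of player $\nu$ and $x^{-\nu}\in\prod_{\mu\in N\setminus\{\nu\}}\mathbb{R}^{n_\mu}$ collects the components of the other players. For $x\in X$ and $\nu\in N$ put $X_\nu(x)=\{y^\nu\in\mathbb{R}^{n_\nu}:\ (y^\nu,x^{-\nu})\in X\}$ and $\mathcal{X}(x)=\prod_{\nu\in N}X_\nu(x)\subset\mathbb{R}^n$ (in general $\mathcal{X}(x)\not\subset X$). Generalized Nash equilibrium in the sense of Rosen (classical solution): a vector $\hat{x}\in X$ such that, for each $\nu\in N$, $\hat{x}^\nu$ minimizes $\theta_\nu(\cdot,\hat{x}^{-\nu})$ over all $x^\nu$ with $(x^\nu,\hat{x}^{-\nu})\in X$; that is, $\theta_\nu(\hat{x})\le\theta_\nu(x^\nu,\hat{x}^{-\nu})$ for all $x^\nu\in X_\nu(\hat{x})$. Projected solution: a vector $\hat{x}\in X$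 for which there exists $\hat{y}\in\mathcal{X}(\hat{x})$ such that (i) $\hat{x}$ is a projection of $\hat{y}$ onto $X$, i.e. $\|\hat{y}-\hat{x}\|\le\|\hat{y}-x\|$ for all $x\in X$; and (ii) $\hat{y}$ is a Nash equilibrium of the game with strategy sets $X_\nu(\hat{x})$, i.e. for each $\nu\in N$, $\theta_\nu(\hat{y})\le\theta_\nu(y^\nu,\hat{y}^{-\nu})$ for all $y^\nu\in X_\nu(\hat{x})$. *)

(* Defs.v *)
From HB Require Import structures.
From mathcomp Require Import all_boot all_order all_algebra.
From mathcomp Require Import classical_sets reals convex.
Set Implicit Arguments.
Unset Strict Implicit.
Unset Printing Implicit Defensive.
Import Order.TTheory GRing.Theory Num.Theory.
Local Open Scope classical_set_scope.
Local Open Scope ring_scope.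

(* An arbitrary norm on a real vector space.  It is a predicate on functions
   because `|_| on 'rV[R]_n is already fixed to be the sup norm.  The axioms
   are those of Lmodule_isNormed; nonnegativity follows from them. *)
Definition is_norm (R : realType) (V : lmodType R) (nrm : V -> R) : Prop :=
  [/\ forall x y, nrm (x + y) <= nrm x + nrm y,
      forall (a : R) x, nrm (a *: x) = `|a| * nrm x
    & forall x, nrm x = 0 -> x = 0].

(* The players are the elements of 'I_p, player nu has strategies in R^(d nu),
   and R^n is the space of row vectors of length n = \sum_mu d mu, divided into
   consecutive blocks: x^nu is submxrow x nu. *)
Section Game.
Variables (R : realType) (p : nat) (d : 'I_p -> nat).
Local Notation Rn := 'rV[R]_(\sum_mu d mu).

(* (y, x^{-nu}) *)
Definition deviation (x : Rn) (nu : 'I_p) (y : 'rV[R]_(d nu)) : Rn :=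
  \mxrow_mu dfwith (submxrow x) y mu.

Definition strategy_set (X : set Rn) (x : Rn) (nu : 'I_p) :
    set 'rV[R]_(d nu) :=
  [set y | X (deviation x y)].
Arguments strategy_set X x nu : clear implicits.

Definition strategy_profiles (X : set Rn) (x : Rn) : set Rn :=
  [set y | forall nu, strategy_set X x nu (submxrow y nu)].

Definition classical_solution (X : set Rn) (theta : 'I_p -> Rn -> R)
    (xh : Rn) : Prop :=
  X xh /\
  forall nu (y : 'rV[R]_(d nu)), strategy_set X xh nu y ->
    theta nu xh <= theta nu (deviation xh y).

Definition is_projection (nrm : Rn -> R) (X : set Rn) (y xh : Rn) : Prop :=
  X xh /\ forall x, X x -> nrm (y - xh) <= nrm (y - x).

Definition nash_equilibrium (S : forall nu : 'I_p, set 'rV[R]_(d nu))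
    (theta : 'I_p -> Rn -> R) (yh : Rn) : Prop :=
  (forall nu, S nu (submxrow yh nu)) /\
  forall nu (y : 'rV[R]_(d nu)), S nu y ->
    theta nu yh <= theta nu (deviation yh y).

Definition projected_solution (nrm : Rn -> R) (X : set Rn)
    (theta : 'I_p -> Rn -> R) (xh : Rn) : Prop :=
  X xh /\
  exists yh, [/\ strategy_profiles X xh yh,
                 is_projection nrm X yh xh
               & nash_equilibrium (strategy_set X xh) theta yh].

End Game.

(* Main.v *)
Require Import Defs.
From mathcomp Require Import all_boot all_order all_algebra.
From mathcomp Require Import classical_sets reals convex.
From mathcomp Require Import interval_inference.
Import Order.TTheory GRing.Theory Num.Theory.
Local Open Scope classical_set_scope.
Local Open Scope ring_scope.

(** Let [xh] be a projected solution with witness [yh]. The [p] points obtained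
    from [xh] by replacing a single block with that of [yh] lie in [X], so their
    average [xh + (yh - xh) / p] does too. As [xh] is nearest to [yh] in [X],
    [||yh - xh|| <= (1 - 1/p) ||yh - xh||], hence [yh = xh], and the Nash
    property of [yh] is the claim. *)

(** Induction on [n]: the average of [n.+2] points is the convex combination of the first one, with
    weight [n.+2%:R^-1], and the average of the others. *)
Lemma convex_set_average (R : numFieldType) (E : lmodType R)
    (A : set (convex_lmodType E)) (n : nat) (f : 'I_n.+1 -> E) :
  convex_set A -> (forall i, A (f i)) -> A (n.+1%:R^-1 *: \sum_i f i).
Proof.
move=> cA; elim: n f => [|n IHn] f Af.
  by rewrite big_ord1 invr1 scale1r.
have n1 : (n.+1%:R : R) != 0 by rewrite pnatr_eq0.
have n2 : (n.+2%:R : R) != 0 by rewrite pnatr_eq0.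
have w_ge0 : 0 <= n.+2%:R^-1 :> R by rewrite invr_ge0.
have w_le1 : n.+2%:R^-1 <= 1 :> R by rewrite invf_le1 ?ltr0n// ler1n.
have := cA _ _ (Itv01 w_ge0 w_le1) (mem_set (Af ord0))
  (mem_set (IHn (fun i => f (lift ord0 i)) (fun i => Af _))).
move=> /set_mem; congr (A _).
rewrite /conv /= /unstable.onem scalerA [in RHS]big_ord_recl scalerDr; congr (_ + _ *: _).
(* The weights of the other points agree because [(1 - 1/(n+2)) / (n+1) = 1/(n+2)]. *)
apply: (mulfI n2); rewrite mulfV // mulrA mulrBr mulr1 mulfV //.
by rewrite -(natrB _ (ltn0Sn n.+1)) subn1 mulfV.
Qed.

(** The triangle inequality for [v] and [- v] gives [0 <= 2 * nrm v]. *)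
Lemma norm_ge0 (R : realType) (V : lmodType R) (nrm : V -> R) (v : V) :
  is_norm nrm -> 0 <= nrm v.
Proof.
case=> nrmD nrmZ _; have := nrmD v (- v).
rewrite subrr -(scale0r v) nrmZ normr0 mul0r -scaleN1r nrmZ normrN1 mul1r.
by rewrite -mulr2n pmulrn_lge0.
Qed.

Section Deviation.
Variables (R : realType) (p : nat) (d : 'I_p -> nat).
Implicit Types x y : 'rV[R]_(\sum_mu d mu).

(** The summand of index [nu] vanishes outside block [nu], where it equals the block of [y - x]. *)
Lemma sum_deviationB x y :
  \sum_nu (deviation x (submxrow y nu) - x) = y - x.
Proof.
apply/mxrowP => j; rewrite submxrow_sum (bigD1 j) //= [X in _ + X]big1 ?addr0.
  by rewrite !submxrowB mxrowK dfwith_in.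
by move=> i ij; rewrite submxrowB mxrowK dfwith_out // subrr.
Qed.

End Deviation.

Theorem proposition3p7 (R : realType) (p : nat) (d : 'I_p -> nat)
    (nrm : 'rV[R]_(\sum_mu d mu) -> R) (hnrm : is_norm nrm)
    (X : set 'rV[R]_(\sum_mu d mu)) (hconv : convex_set X) (hX : X !=set0)
    (theta : 'I_p -> 'rV[R]_(\sum_mu d mu) -> R)
    (xh : 'rV[R]_(\sum_mu d mu)) :
  projected_solution nrm X theta xh -> classical_solution X theta xh.
Proof.
case=> Xxh [yh [yS [_ xproj] [_ yNash]]]; split=> // nu.
suff yx : yh = xh by move: yNash; rewrite yx => /(_ nu).
(* The average needs at least one point; for [p = 0] there is no player [nu] to consider. *)
case: p d nrm hnrm X hconv hX theta xh Xxh yh yS xproj yNash nu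
  => [|q] d nrm nrmP X cX _ theta x Xx y yS xproj _ nu.
  by case: nu.
case: (nrmP) => _ nrmZ nrm0.
(* Unfolded, [yS] says that every [deviation x (submxrow y nu)] lies in [X]; [z] is their
   average. *)
have := @convex_set_average R _ X q _ cX yS.
set z := _ *: _ => Xz.
have q1 : (q.+1%:R : R) != 0 by rewrite pnatr_eq0.
have zx : q.+1%:R^-1 *: (y - x) = z - x.
  rewrite -sum_deviationB sumrB sumr_const card_ord scalerBr -/z.
  by rewrite -scaler_nat scalerA mulVf // scale1r.
have yz : y - z = (1 - q.+1%:R^-1) *: (y - x).
  by rewrite scalerBl scale1r zx opprB addrA subrK.
have := xproj _ Xz.
rewrite yz nrmZ ger0_norm; last first.
  by rewrite subr_ge0 invf_le1 ?ltr0n// ler1n.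
(* Cancelling [nrm (y - x)] on both sides leaves [q.+1%:R^-1 * nrm (y - x) <= 0]. *)
rewrite mulrBl mul1r lerBrDr gerDl pmulr_rle0 ?invr_gt0 ?ltr0n // => le0.
apply/eqP; rewrite -subr_eq0; apply/eqP/nrm0/le_anti.
by rewrite le0 norm_ge0.
Qed.
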